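(* Let $R$ be a commutative, non-noetherian absolutely flat ring which is not semi-artinian. Then $\mathsf{D}(R)$ admits a localising subcategory which is not a Bousfield class.
   Context: All rings are commutative and unital. A ring $R$ is absolutely flat (von Neumann regular) if for every $r\in R$ there is $x\in R$ with $r=r^2x$. A ring $R$ is semi-artinian if every non-zero homomorphic image of $R$, in the category of $R$-modules, contains a simple submodule. $\mathsf{D}(R)$ is the unbounded derived category of $R$-modules with its tensor product $\otimes = \otimes_R$ (all modules over an absolutely flat ring are flat). A localising subcategory is a full triangulated subcategory closed under arbitrary coproducts. A localising subcategory $\mathcal{L}$ of $\mathsf{D}(R)$ is a Bousfield class if there is an $X\in\mathsf{D}(R)$ such that $\mathcal{L} = \{Y\in\mathsf{D}(R) \mid X\otimes Y\cong 0\}$. *)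

(* Defs.v *)
From HB Require Import structures.
From mathcomp Require Import all_boot all_order all_algebra.
From mathcomp Require Import generic_quotient.
From mathcomp Require Import boolp classical_sets functions cardinality fsbigop.

Set Implicit Arguments.
Unset Strict Implicit.
Unset Printing Implicit Defensive.

Import GRing.Theory.

Local Open Scope quotient_scope.
Local Open Scope classical_set_scope.
Local Open Scope ring_scope.

(** * Rings and modules

    Rings are [comPzRingType]s, so that the zero ring is not excluded a priori.
    Submodules are boolean predicates satisfying [GRing.submod_closed]; with
    the classical axioms of [boolp] every [Prop]-valued predicate is of this
    form.  Ideals are the submodules of the regular module [R^o]. *)

Definition absolutely_flat (R : comPzRingType) : Prop :=
  forall r : R, exists x : R, r = r ^+ 2 * x.

Definition noetherian (R : comPzRingType) : Prop :=
  forall I : {pred R^o}, GRing.submod_closed I ->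
    exists (n : nat) (g : 'I_n -> R),
      forall x : R, x \in I <-> exists c : 'I_n -> R, x = \sum_(i < n) c i * g i.

Definition simple_submod (R : comPzRingType) (M : lmodType R) (S : {pred M}) :
    Prop :=
  [/\ GRing.submod_closed S,
      exists2 x : M, x \in S & x != 0 &
      forall T : {pred M}, GRing.submod_closed T -> {subset T <= S} ->
        (forall x, x \in T -> x = 0) \/ {subset S <= T}].

Definition semi_artinian (R : comPzRingType) : Prop :=
  forall (M : lmodType R) (f : {linear R^o -> M}),
    (forall y : M, exists x : R^o, f x = y) -> (exists y : M, y != 0) ->
    exists S : {pred M}, simple_submod S.

(** * Direct sums of modules: families with finite support *)

Section DirectSum.
Variables (R : comPzRingType) (I : choiceType) (M : I -> lmodType R).

Record dsum : Type := DSum {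
  dsum_fun :> forall i, M i;
  dsum_fin : finite_set [set i | dsum_fun i <> 0]
}.

HB.instance Definition _ := gen_eqMixin dsum.
HB.instance Definition _ := gen_choiceMixin dsum.

Lemma dsum_ext (u v : dsum) : (forall i, u i = v i) -> u = v.
Proof.
case: u v => [f fP] [g gP] /= fg.
have {}fg : f = g by apply: functional_extensionality_dep.
by move: fP; rewrite fg => fP; rewrite (Prop_irrelevance fP gP).
Qed.

Fact dsum_zero_fin : finite_set [set i | (fun i => 0 : M i) i <> 0].
Proof. by apply: (sub_finite_set _ (finite_set0 I)) => i /=. Qed.
Definition dsum_zero := DSum dsum_zero_fin.

Fact dsum_opp_fin (u : dsum) : finite_set [set i | - u i <> 0].
Proof.
apply: (sub_finite_set _ (dsum_fin u)) => i /= h u0.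
by apply: h; rewrite u0 oppr0.
Qed.
Definition dsum_opp u := DSum (dsum_opp_fin u).

Fact dsum_add_fin (u v : dsum) : finite_set [set i | u i + v i <> 0].
Proof.
apply: (sub_finite_set (B := [set i | u i <> 0] `|` [set i | v i <> 0])).
  move=> i /= h; have [u0|/eqP u0] := eqVneq (u i) 0; last by left.
  by right=> v0; apply: h; rewrite u0 v0 addr0.
by rewrite finite_setU; split; apply: dsum_fin.
Qed.
Definition dsum_add u v := DSum (dsum_add_fin u v).

Fact dsum_scale_fin (a : R) (u : dsum) : finite_set [set i | a *: u i <> 0].
Proof.
apply: (sub_finite_set _ (dsum_fin u)) => i /= h u0.
by apply: h; rewrite u0 scaler0.
Qed.
Definition dsum_scale a u := DSum (dsum_scale_fin a u).

Fact dsum_addA : associative dsum_add.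
Proof. by move=> u v w; apply: dsum_ext => i /=; rewrite addrA. Qed.
Fact dsum_addC : commutative dsum_add.
Proof. by move=> u v; apply: dsum_ext => i /=; rewrite addrC. Qed.
Fact dsum_add0 : left_id dsum_zero dsum_add.
Proof. by move=> u; apply: dsum_ext => i /=; rewrite add0r. Qed.
Fact dsum_addN : left_inverse dsum_zero dsum_opp dsum_add.
Proof. by move=> u; apply: dsum_ext => i /=; rewrite addNr. Qed.

HB.instance Definition _ :=
  GRing.isZmodule.Build dsum dsum_addA dsum_addC dsum_add0 dsum_addN.

Fact dsum_scaleA a b u : dsum_scale a (dsum_scale b u) = dsum_scale (a * b) u.
Proof. by apply: dsum_ext => i /=; rewrite scalerA. Qed.
Fact dsum_scale1 : left_id 1 dsum_scale.
Proof. by move=> u; apply: dsum_ext => i /=; rewrite scale1r. Qed.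
Fact dsum_scaleDr : right_distributive dsum_scale +%R.
Proof. by move=> a u v; apply: dsum_ext => i /=; rewrite scalerDr. Qed.
Fact dsum_scaleDl u : {morph dsum_scale^~ u : a b / a + b}.
Proof. by move=> a b; apply: dsum_ext => i /=; rewrite scalerDl. Qed.

HB.instance Definition _ := GRing.Zmodule_isLmodule.Build R dsum
  dsum_scaleA dsum_scale1 dsum_scaleDr dsum_scaleDl.

Definition dsum_in_fun (i : I) (x : M i) (j : I) : M j :=
  if pselect (i = j) is left e then eq_rect i M x j e else 0.

Fact dsum_in_fin i (x : M i) : finite_set [set j | dsum_in_fun x j <> 0].
Proof.
apply: (sub_finite_set _ (finite_set1 i)) => j /=.
by rewrite /dsum_in_fun; case: pselect.
Qed.

Definition dsum_in i (x : M i) : dsum := DSum (dsum_in_fin x).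

Fact dsum_in_linear i : linear (@dsum_in i).
Proof.
move=> a x y; apply: dsum_ext => j; rewrite /= /dsum_in_fun.
by case: pselect => [e|_] /=; [case: _ / e | rewrite scaler0 addr0].
Qed.
HB.instance Definition _ i :=
  GRing.isLinear.Build R (M i) dsum *:%R (@dsum_in i) (@dsum_in_linear i).

Lemma dsum_suppP (u : dsum) :
  exists2 r : seq I, uniq r & forall i, i \notin r -> u i = 0.
Proof.
have /finite_seqP [r e] := dsum_fin u.
exists (undup r) => [|i]; first exact: undup_uniq.
rewrite mem_undup => ir; apply: contrapT => ui.
by move/negP: ir; apply; suff: [set` r] i by []; rewrite -e.
Qed.

Section Lift.
Variables (P : lmodType R) (h : forall i, {linear M i -> P}).

Definition dsum_lift (u : dsum) : P := \sum_(i \in [set: I]) h i (u i).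

Lemma dsum_liftE (r : seq I) (u : dsum) : uniq r ->
  (forall i, i \notin r -> u i = 0) -> dsum_lift u = \sum_(i <- r) h i (u i).
Proof.
move=> ur u0; rewrite /dsum_lift [RHS]fsbig_seq // -(fsbig_widen [set` r] setT) //.
by move=> i [_ /negP ir]; rewrite /preimage /= u0 ?linear0.
Qed.

Fact dsum_lift_linear : linear dsum_lift.
Proof.
move=> a u v.
have [r ur [u0 v0]] : exists2 r : seq I, uniq r &
    (forall i, i \notin r -> u i = 0) /\ (forall i, i \notin r -> v i = 0).
  have [r1 _ u0] := dsum_suppP u; have [r2 _ v0] := dsum_suppP v.
  exists (undup (r1 ++ r2)); first exact: undup_uniq.
  by split=> i; rewrite mem_undup mem_cat negb_or => /andP[/u0 + /v0].
rewrite !(dsum_liftE ur) //; last first.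
  by move=> i ir /=; rewrite u0 // v0 // scaler0 addr0.
by rewrite scaler_sumr -big_split; apply: eq_bigr => i _ /=; rewrite linearP.
Qed.
HB.instance Definition _ :=
  GRing.isLinear.Build R dsum P *:%R dsum_lift dsum_lift_linear.

Lemma dsum_lift_in i (x : M i) : dsum_lift (dsum_in x) = h i x.
Proof.
rewrite (@dsum_liftE [:: i]) //=; last first.
  move=> j; rewrite inE /dsum_in_fun; case: pselect => // e.
  by move=> /negP[]; apply/eqP.
rewrite big_seq1 /dsum_in_fun; case: pselect => // e.
by rewrite (Prop_irrelevance e erefl).
Qed.
End Lift.

Lemma dsum_sum (u : dsum) : \sum_(i \in [set: I]) dsum_in (u i) = u.
Proof.
have [r ur u0] := dsum_suppP u.
have -> : \sum_(i \in [set: I]) dsum_in (u i) = \sum_(i <- r) dsum_in (u i).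
  exact: (dsum_liftE (fun i => @dsum_in i) ur u0).
apply: dsum_ext => j.
have -> : (\sum_(i <- r) dsum_in (u i)) j = \sum_(i <- r) dsum_in (u i) j.
  by apply: (big_morph (fun v : dsum => v j)).
have dsum_in_neq i : i != j -> dsum_in (u i) j = 0.
  by move=> /eqP ij; rewrite /= /dsum_in_fun; case: pselect.
have [jr|jr] := boolP (j \in r); last first.
  rewrite u0 // big_seq big1 // => i ir; apply: dsum_in_neq.
  by apply: contraNneq jr => <-.
rewrite (bigD1_seq j) //= big1 ?addr0 => [|i /dsum_in_neq //].
rewrite /dsum_in_fun; case: pselect => // e.
by rewrite (Prop_irrelevance e erefl).
Qed.
End DirectSum.

(** * Tensor products of modules: formal sums of pairs [(x, y)] modulo the
    congruence generated by bilinearity *)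

Section Tensor.
Variables (R : comPzRingType) (M N : lmodType R).
Implicit Types s t : seq (M * N).

Inductive tensor_rel : seq (M * N) -> seq (M * N) -> Prop :=
| tensor_refl s : tensor_rel s s
| tensor_sym s t : tensor_rel s t -> tensor_rel t s
| tensor_trans s t u : tensor_rel s t -> tensor_rel t u -> tensor_rel s u
| tensor_cat s s' t t' :
    tensor_rel s s' -> tensor_rel t t' -> tensor_rel (s ++ t) (s' ++ t')
| tensor_catC s t : tensor_rel (s ++ t) (t ++ s)
| tensor_addl x x' y : tensor_rel [:: (x + x', y)] [:: (x, y); (x', y)]
| tensor_addr x y y' : tensor_rel [:: (x, y + y')] [:: (x, y); (x, y')]
| tensor_scale (a : R) x y : tensor_rel [:: (a *: x, y)] [:: (x, a *: y)]
| tensor_zero y : tensor_rel [:: (0, y)] [::].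

Definition tensor_relb s t : bool := `[< tensor_rel s t >].

Fact tensor_relb_equiv : equiv_class_of tensor_relb.
Proof.
split=> [s|s t|s t u].
- exact/asboolP/tensor_refl.
- by apply/asboolP/asboolP; apply: tensor_sym.
- by move=> /asboolP st /asboolP tu; apply/asboolP/(tensor_trans st tu).
Qed.
Canonical tensor_equiv := EquivRelPack tensor_relb_equiv.

Definition tensor : Type := {eq_quot tensor_equiv}.
HB.instance Definition _ := Choice.on tensor.
HB.instance Definition _ := Quotient.on tensor.

Definition tensor_class s : tensor := \pi_tensor s.

Lemma tensor_classP s t : tensor_class s = tensor_class t <-> tensor_rel s t.
Proof. by split=> [/eqmodP/asboolP//|st]; exact/eqmodP/asboolP. Qed.

Lemma tensor_class_repr (u : tensor) :
  tensor_class (repr u) = u.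
Proof. exact: reprK. Qed.

Lemma tensor_repr_rel s :
  tensor_rel (repr (tensor_class s)) s.
Proof. by apply/tensor_classP; rewrite tensor_class_repr. Qed.

Lemma tensor_ind (Q : tensor -> Prop) :
  (forall s, Q (tensor_class s)) -> forall u, Q u.
Proof. by move=> QP u; rewrite -(tensor_class_repr u). Qed.

Definition tensor_map_seq (a : R) s := [seq (a *: p.1, p.2) | p <- s].

Lemma tensor_map_rel a s t :
  tensor_rel s t -> tensor_rel (tensor_map_seq a s) (tensor_map_seq a t).
Proof.
elim=> {s t} [s|s t _ IH|s t u _ IH1 _ IH2|s s' t t' _ IH1 _ IH2|s t|||b x y|y].
- exact: tensor_refl.
- exact: tensor_sym.
- exact: tensor_trans IH1 IH2.
- by rewrite /tensor_map_seq !map_cat; apply: tensor_cat.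
- by rewrite /tensor_map_seq !map_cat; apply: tensor_catC.
- by move=> x x' y /=; rewrite scalerDr; apply: tensor_addl.
- by move=> x y y'; apply: tensor_addr.
- by rewrite /= scalerA mulrC -scalerA; apply: tensor_scale.
- by rewrite /= scaler0; apply: tensor_zero.
Qed.

Definition tensor_add (u v : tensor) : tensor :=
  tensor_class (repr u ++ repr v).
Definition tensor_mul (a : R) (u : tensor) : tensor :=
  tensor_class (tensor_map_seq a (repr u)).

Lemma tensor_addE s t :
  tensor_add (tensor_class s) (tensor_class t) = tensor_class (s ++ t).
Proof. by apply/tensor_classP/tensor_cat; apply: tensor_repr_rel. Qed.

Lemma tensor_mulE a s :
  tensor_mul a (tensor_class s) = tensor_class (tensor_map_seq a s).
Proof. exact/tensor_classP/tensor_map_rel/tensor_repr_rel. Qed.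

Fact tensor_addA : associative tensor_add.
Proof.
by elim/tensor_ind=> s; elim/tensor_ind=> t; elim/tensor_ind=> u;
   rewrite !tensor_addE catA.
Qed.

Fact tensor_addC : commutative tensor_add.
Proof.
elim/tensor_ind=> s; elim/tensor_ind=> t.
by rewrite !tensor_addE; apply/tensor_classP/tensor_catC.
Qed.

Fact tensor_add0 : left_id (tensor_class [::]) tensor_add.
Proof. by elim/tensor_ind=> s; rewrite tensor_addE. Qed.

(* An identity between formal sums that holds for pairs holds for all sums. *)
Lemma tensor_rel_map (f g h : M * N -> M * N) s :
  (forall p, tensor_rel [:: f p] [:: g p; h p]) ->
  tensor_rel (map f s) (map g s ++ map h s).
Proof.
move=> fgh; elim: s => [|p s IH] /=; first exact: tensor_refl.
apply: tensor_trans (tensor_cat (fgh p) IH) _ => /=.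
apply: (tensor_cat (s := [:: _]) (s' := [:: _])); first exact: tensor_refl.
rewrite -(cat1s (h p) (_ ++ _)) -(cat1s (h p) (map h s)) !catA.
by apply: tensor_cat; [exact: tensor_catC|exact: tensor_refl].
Qed.

Lemma tensor_map0 s : tensor_rel (tensor_map_seq 0 s) [::].
Proof.
elim: s => [|p s IH] /=; first exact: tensor_refl.
by apply: (tensor_cat (s := [:: _]) (s' := [::])) IH; rewrite scale0r;
   apply: tensor_zero.
Qed.

Fact tensor_mulA a b u : tensor_mul a (tensor_mul b u) = tensor_mul (a * b) u.
Proof.
elim/tensor_ind: u => s; rewrite !tensor_mulE /tensor_map_seq -map_comp.
by congr tensor_class; apply: eq_map => p /=; rewrite scalerA.
Qed.

Fact tensor_mul1 : left_id 1 tensor_mul.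
Proof.
elim/tensor_ind=> s; rewrite tensor_mulE /tensor_map_seq.
by congr tensor_class; apply: map_id_in => -[x y] _ /=; rewrite scale1r.
Qed.

Fact tensor_mulDr a u v :
  tensor_mul a (tensor_add u v) = tensor_add (tensor_mul a u) (tensor_mul a v).
Proof.
elim/tensor_ind: u => s; elim/tensor_ind: v => t.
by rewrite !(tensor_addE, tensor_mulE) /tensor_map_seq map_cat.
Qed.

Fact tensor_mulDl a b u :
  tensor_mul (a + b) u = tensor_add (tensor_mul a u) (tensor_mul b u).
Proof.
elim/tensor_ind: u => s; rewrite !(tensor_addE, tensor_mulE).
apply/tensor_classP/tensor_rel_map => p.
by rewrite scalerDl; apply: tensor_addl.
Qed.

Fact tensor_addN :
  left_inverse (tensor_class [::]) (tensor_mul (- 1)) tensor_add.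
Proof.
move=> u; rewrite -[X in tensor_add _ X]tensor_mul1 -tensor_mulDl addNr.
by elim/tensor_ind: u => s; rewrite tensor_mulE; apply/tensor_classP/tensor_map0.
Qed.

HB.instance Definition _ :=
  GRing.isZmodule.Build tensor tensor_addA tensor_addC tensor_add0 tensor_addN.
HB.instance Definition _ := GRing.Zmodule_isLmodule.Build R tensor
  tensor_mulA tensor_mul1 tensor_mulDr (fun u a b => tensor_mulDl a b u).

Definition pure (x : M) (y : N) : tensor := tensor_class [:: (x, y)].

Lemma tensor_class_sum s : tensor_class s = \sum_(p <- s) pure p.1 p.2.
Proof.
elim: s => [|[x y] s IH]; first by rewrite big_nil.
by rewrite big_cons -IH -cat1s -tensor_addE.
Qed.

Section Lift.
Variables (P : lmodType R) (b : M -> N -> P).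
Hypothesis (b_linl : forall y, linear (b^~ y)) (b_linr : forall x, linear (b x)).

Definition tensor_lift (_ : forall y, linear (b^~ y))
    (_ : forall x, linear (b x)) (u : tensor) : P :=
  \sum_(p <- repr u) b p.1 p.2.

Local Notation lift := (tensor_lift b_linl b_linr).

Lemma tensor_lift_rel s t : tensor_rel s t ->
  \sum_(p <- s) b p.1 p.2 = \sum_(p <- t) b p.1 p.2.
Proof.
elim=> {s t} [//|s t _ //|s t u _ -> _ -> //|s s' t t' _ e1 _ e2|s t|||a x y|y].
- by rewrite !big_cat /= e1 e2.
- by rewrite !big_cat /= addrC.
- move=> x x' y; rewrite !big_cons !big_nil /= !addr0.
  by have := b_linl y 1 x x'; rewrite !scale1r.
- move=> x y y'; rewrite !big_cons !big_nil /= !addr0.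
  by have := b_linr x 1 y y'; rewrite !scale1r.
- rewrite !big_cons !big_nil /= !addr0.
  have b0y : b 0 y = 0.
    by have := b_linl y (- 1) 0 0; rewrite scaler0 addr0 scaleN1r addNr.
  have bx0 : b x 0 = 0.
    by have := b_linr x (- 1) 0 0; rewrite scaler0 addr0 scaleN1r addNr.
  have := b_linl y a x 0; have := b_linr x a y 0.
  by rewrite !addr0 b0y bx0 !addr0 => -> ->.
- rewrite big_cons !big_nil /= addr0.
  by have := b_linl y (- 1) 0 0; rewrite scaler0 addr0 scaleN1r addNr.
Qed.

Lemma tensor_lift_class s : lift (tensor_class s) = \sum_(p <- s) b p.1 p.2.
Proof. exact/tensor_lift_rel/tensor_repr_rel. Qed.

Lemma tensor_lift_pure x y : lift (pure x y) = b x y.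
Proof. by rewrite tensor_lift_class big_seq1. Qed.

Fact tensor_lift_linear : linear lift.
Proof.
move=> a; elim/tensor_ind=> s; elim/tensor_ind=> t.
rewrite [a *: _]tensor_mulE [_ + _]tensor_addE !tensor_lift_class big_cat /=.
congr (_ + _); rewrite scaler_sumr big_map; apply: eq_bigr => p _ /=.
have b0 : b 0 p.2 = 0.
  by have := b_linl p.2 (- 1) 0 0; rewrite scaler0 addr0 scaleN1r addNr.
by have := b_linl p.2 a p.1 0; rewrite !addr0 b0 addr0.
Qed.
HB.instance Definition _ :=
  GRing.isLinear.Build R tensor P *:%R lift tensor_lift_linear.
End Lift.

Lemma pure_linl y : linear (pure^~ y).
Proof.
move=> a x x'.
have -> : a *: pure x y = pure (a *: x) y by apply: tensor_mulE.
transitivity (tensor_class ([:: (a *: x, y)] ++ [:: (x', y)])).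
  exact/tensor_classP/tensor_addl.
by rewrite -tensor_addE.
Qed.

Lemma pure_linr x : linear (pure x).
Proof.
move=> a y y'.
have -> : a *: pure x y = pure x (a *: y).
  rewrite [LHS]tensor_mulE; exact/tensor_classP/tensor_scale.
transitivity (tensor_class ([:: (x, a *: y)] ++ [:: (x, y')])).
  exact/tensor_classP/tensor_addr.
by rewrite -tensor_addE.
Qed.

Lemma pure0l y : pure 0 y = 0.
Proof.
by have := pure_linl y (- 1) 0 0; rewrite scaler0 addr0 scaleN1r addNr.
Qed.

Lemma pure0r x : pure x 0 = 0.
Proof.
by have := pure_linr x (- 1) 0 0; rewrite scaler0 addr0 scaleN1r addNr.
Qed.
End Tensor.

(** * Unbounded complexes, with differential of degree [+1] *)

Record complex (R : comPzRingType) := Complex {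
  cx_obj :> int -> lmodType R;
  cx_d : forall i, {linear cx_obj i -> cx_obj (i + 1)};
  cx_dd : forall i (x : cx_obj i), cx_d (i + 1) (cx_d i x) = 0
}.

Record chain_map (R : comPzRingType) (X Y : complex R) := ChainMap {
  cm_fun :> forall i, {linear X i -> Y i};
  cm_comm : forall i (x : X i), cm_fun (i + 1) (cx_d X i x) = cx_d Y i (cm_fun i x)
}.

Section Complexes.
Variable R : comPzRingType.
Implicit Types X Y Z : complex R.

Program Definition cm_id X : chain_map X X := @ChainMap R X X (fun i => idfun) _.

Program Definition cm_comp X Y Z (g : chain_map Y Z) (f : chain_map X Y) :
    chain_map X Z := @ChainMap R X Z (fun i => g i \o f i) _.
Next Obligation. by rewrite /= !cm_comm. Qed.

Definition cx_zero : complex R :=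
  @Complex R (fun=> 'rV[R]_0) (fun=> \0) (fun _ _ => erefl).

(* As [i] ranges over all integers, so does the degree [i + 1] below. *)
Definition is_cycle X i (x : X (i + 1)) : Prop := cx_d X (i + 1) x = 0.
Definition is_boundary X i (x : X (i + 1)) : Prop :=
  exists y : X i, cx_d X i y = x.

(* [H(f)] is injective and surjective in every degree. *)
Definition quasi_iso X Y (f : chain_map X Y) : Prop :=
  forall i,
    (forall x : X (i + 1), is_cycle x -> is_boundary (f (i + 1) x) ->
       is_boundary x) /\
    (forall y : Y (i + 1), is_cycle y ->
       exists2 x : X (i + 1), is_cycle x & is_boundary (y - f (i + 1) x)).

Section Shift.
Variable X : complex R.

Definition shift_d i : {linear X (i + 1) -> X (i + 1 + 1)} :=
  \- cx_d X (i + 1).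

Fact shift_dd i (x : X (i + 1)) : shift_d (i + 1) (shift_d i x) = 0.
Proof. by rewrite /= linearN cx_dd !oppr0. Qed.

Definition shift : complex R := @Complex R (fun i => X (i + 1)) shift_d shift_dd.
End Shift.

Program Definition cm_shift X Y (f : chain_map X Y) :
    chain_map (shift X) (shift Y) :=
  @ChainMap R (shift X) (shift Y) (fun i => f (i + 1)) _.
Next Obligation. by rewrite /= linearN cm_comm. Qed.

Lemma quasi_iso_shift X Y (f : chain_map X Y) :
  quasi_iso f -> quasi_iso (cm_shift f).
Proof.
have oppB Z i (z : Z (i + 1 + 1)) :
    @is_boundary (shift Z) i z <-> @is_boundary Z (i + 1) z.
  split=> -[y /= <-].
    by exists (- y); rewrite linearN.
  by exists (- y); rewrite /= linearN opprK.
have oppC Z i (z : Z (i + 1 + 1)) :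
    @is_cycle (shift Z) i z <-> @is_cycle Z (i + 1) z.
  rewrite /is_cycle /=; split=> [e|->]; last by rewrite oppr0.
  by rewrite -[LHS]opprK e oppr0.
move=> fq i; have [finj fsurj] := fq (i + 1); split=> [x|y].
  by move=> /oppC xc /oppB fx; apply/oppB/finj.
by move=> /oppC /fsurj [x /oppC xc /oppB yx]; exists x.
Qed.

(** ** Mapping cones *)

Section Cone.
Variables (X Y : complex R) (f : chain_map X Y).

Definition cone_d_fun i (p : X (i + 1) * Y i) : X (i + 1 + 1) * Y (i + 1) :=
  (- cx_d X (i + 1) p.1, f (i + 1) p.1 + cx_d Y i p.2).

Fact cone_d_linear i : linear (@cone_d_fun i).
Proof.
move=> a [x y] [x' y']; rewrite /cone_d_fun /=; congr (_, _); rewrite /= !linearP //=.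
by rewrite scalerDr addrACA.
Qed.
HB.instance Definition _ i :=
  GRing.isLinear.Build R _ _ *:%R (@cone_d_fun i) (@cone_d_linear i).

Definition cone_obj (i : int) : lmodType R := (X (i + 1)%R * Y i)%type.

Definition cone_d i : {linear cone_obj i -> cone_obj (i + 1)} :=
  @cone_d_fun i.

Fact cone_dd i p : cone_d (i + 1) (cone_d i p) = 0.
Proof.
case: p => x y; rewrite /= /cone_d_fun /=; congr (_, _).
  by rewrite linearN cx_dd !oppr0.
by rewrite linearN linearD /= cx_dd cm_comm addr0 addNr.
Qed.

Definition cone : complex R :=
  @Complex R cone_obj cone_d cone_dd.

Definition cone_in_fun i (y : Y i) : X (i + 1) * Y i := (0, y).
Fact cone_in_linear i : linear (@cone_in_fun i).
Proof. by move=> a y y'; congr (_, _); rewrite /= scaler0 addr0. Qed.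
HB.instance Definition _ i :=
  GRing.isLinear.Build R _ _ *:%R (@cone_in_fun i) (@cone_in_linear i).

Program Definition cone_in : chain_map Y cone :=
  @ChainMap R Y cone (fun i => @cone_in_fun i) _.
Next Obligation.
by rewrite /= /cone_d_fun /cone_in_fun /= !linear0 add0r.
Qed.

Program Definition cone_out : chain_map cone (shift X) :=
  @ChainMap R cone (shift X) (fun i => fst) _.
End Cone.

(** ** Tensor products of complexes

    The degree [n] term is the direct sum of the [X i ⊗ Y j] with [i + j = n];
    over an absolutely flat ring every complex is K-flat, so that this also is
    the derived tensor product. *)

Section TensorComplex.
Variables X Y : complex R.

Definition bideg (n : int) : Type := {p : int * int | p.1 + p.2 == n}.
HB.instance Definition _ n := Choice.on (bideg n).

Definition tot_summand n (p : bideg n) : lmodType R :=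
  tensor (X (val p).1) (Y (val p).2).

Definition tot (n : int) : lmodType R := dsum (@tot_summand n).

Definition tot_in (n i j : int) (e : i + j == n) :
    {linear tensor (X i) (Y j) -> tot n} :=
  let p : bideg n := exist _ (i, j) e in
  @dsum_in R (bideg n) (@tot_summand n) p : {linear tot_summand p -> dsum _}.

Fact bideg_left n (p : bideg n) : (val p).1 + 1 + (val p).2 == n + 1.
Proof. by rewrite addrAC (eqP (valP p)). Qed.
Fact bideg_right n (p : bideg n) : (val p).1 + ((val p).2 + 1) == n + 1.
Proof. by rewrite addrA (eqP (valP p)). Qed.

Definition tot_d_pure n (p : bideg n) (x : X (val p).1) (y : Y (val p).2) :
    tot (n + 1) :=
  tot_in (bideg_left p) (pure (cx_d X _ x) y) +
  (-1) ^+ absz (val p).1 *: tot_in (bideg_right p) (pure x (cx_d Y _ y)).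

Fact tot_d_linl n (p : bideg n) y : linear ((@tot_d_pure n p)^~ y).
Proof.
move=> a x x'; rewrite /tot_d_pure linearP /= !pure_linl !linearP /=.
by rewrite scalerDr addrACA.
Qed.
Fact tot_d_linr n (p : bideg n) x : linear (@tot_d_pure n p x).
Proof.
move=> a y y'; rewrite /tot_d_pure linearP /= !pure_linr !linearP /=.
by rewrite scalerDr addrACA.
Qed.

Definition tot_d n : {linear tot n -> tot (n + 1)} :=
  dsum_lift (fun p : bideg n =>
    tensor_lift (@tot_d_linl n p) (@tot_d_linr n p)
      : {linear tot_summand p -> tot (n + 1)}).

Lemma tot_d_in n i j (e : i + j == n) (x : X i) (y : Y j) :
  tot_d n (tot_in e (pure x y)) = @tot_d_pure n (exist _ (i, j) e) x y.
Proof.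
by rewrite /tot_d /tot_in /= dsum_lift_in /= tensor_lift_pure.
Qed.

Lemma tot_in_irr n i j (e e' : i + j == n) t : tot_in e t = tot_in e' t.
Proof. by rewrite (bool_irrelevance e e'). Qed.

Lemma tot_ind n (Q : tot n -> Prop) :
  (forall u v, Q u -> Q v -> Q (u + v)) -> Q 0 ->
  (forall i j (e : i + j == n) x y, Q (tot_in e (pure x y))) -> forall u, Q u.
Proof.
move=> QD Q0 Qin u; rewrite -(dsum_sum u); apply: big_ind => // -[[i j] e] _.
elim/tensor_ind: (u _) => s; rewrite tensor_class_sum.
have -> t : @dsum_in R (bideg n) (@tot_summand n) (exist _ (i, j) e) t =
    tot_in e t by [].
by rewrite linear_sum; apply: big_ind => // -[x y] _; apply: Qin.
Qed.

Lemma signr_int (i : int) : (-1) ^+ absz (i + 1) = - (-1) ^+ absz i :> R.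
Proof.
case: i => [k|k]; first by rewrite -PoszD addn1 /= exprS mulN1r.
have -> : (Negz k + 1)%R = - k%:Z by rewrite NegzE -addn1 PoszD opprD addrNK.
by rewrite abszN /= exprS mulN1r opprK.
Qed.

Fact tot_dd n (u : tot n) : tot_d (n + 1) (tot_d n u) = 0.
Proof.
elim/tot_ind: u => [u v u0 v0||i j e x y]; last 1 first.
- rewrite tot_d_in /tot_d_pure linearD linearZ.
  set el := bideg_left _; set er := bideg_right _.
  have -> : tot_d (n + 1) (tot_in el (pure (cx_d X i x) y)) =
      (-1) ^+ absz (i + 1) *: tot_in (bideg_right (exist _ (i + 1, j) el))
                                (pure (cx_d X i x) (cx_d Y j y)).
    by rewrite tot_d_in /tot_d_pure cx_dd pure0l linear0 add0r.
  have -> : tot_d (n + 1) (tot_in er (pure x (cx_d Y j y))) =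
      tot_in (bideg_left (exist _ (i, j + 1) er))
                                (pure (cx_d X i x) (cx_d Y j y)).
    by rewrite tot_d_in /tot_d_pure cx_dd pure0r linear0 scaler0 addr0.
  set e1 := bideg_right _; set e2 := bideg_left _.
  by rewrite (tot_in_irr e1 e2) signr_int scaleNr addNr.
- by rewrite !linearD /= u0 v0 addr0.
- by rewrite !linear0.
Qed.

Definition tensor_cx : complex R := @Complex R tot tot_d tot_dd.
End TensorComplex.
End Complexes.

(** * The derived category [D(R)]

    [D(R)] is the localisation of the category of complexes at the
    quasi-isomorphisms, presented by generators and relations: its objects are
    the complexes, and its morphisms are the terms of [dmor] modulo the
    congruence [dm_eq].  Composition [dm_comp u v] is in diagrammatic order. *)

Section Derived.
Variable R : comPzRingType.
Implicit Types X Y Z W : complex R.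

Inductive dmor : complex R -> complex R -> Type :=
| dm_of X Y : chain_map X Y -> dmor X Y
| dm_inv X Y (s : chain_map X Y) : quasi_iso s -> dmor Y X
| dm_comp X Y Z : dmor X Y -> dmor Y Z -> dmor X Z.

Definition dm_id X : dmor X X := dm_of (cm_id X).

Inductive dm_eq : forall X Y, dmor X Y -> dmor X Y -> Prop :=
| dm_refl X Y (u : dmor X Y) : dm_eq u u
| dm_sym X Y (u v : dmor X Y) : dm_eq u v -> dm_eq v u
| dm_trans X Y (u v w : dmor X Y) : dm_eq u v -> dm_eq v w -> dm_eq u w
| dm_congr X Y Z (u u' : dmor X Y) (v v' : dmor Y Z) :
    dm_eq u u' -> dm_eq v v' -> dm_eq (dm_comp u v) (dm_comp u' v')
| dm_assoc X Y Z W (u : dmor X Y) (v : dmor Y Z) (w : dmor Z W) :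
    dm_eq (dm_comp u (dm_comp v w)) (dm_comp (dm_comp u v) w)
| dm_idl X Y (u : dmor X Y) : dm_eq (dm_comp (dm_id X) u) u
| dm_idr X Y (u : dmor X Y) : dm_eq (dm_comp u (dm_id Y)) u
| dm_of_comp X Y Z (f : chain_map X Y) (g : chain_map Y Z) :
    dm_eq (dm_comp (dm_of f) (dm_of g)) (dm_of (cm_comp g f))
| dm_invr X Y (s : chain_map X Y) (hs : quasi_iso s) :
    dm_eq (dm_comp (dm_of s) (dm_inv hs)) (dm_id X)
| dm_invl X Y (s : chain_map X Y) (hs : quasi_iso s) :
    dm_eq (dm_comp (dm_inv hs) (dm_of s)) (dm_id Y).

Definition dm_iso X Y (u : dmor X Y) : Prop :=
  exists2 v : dmor Y X, dm_eq (dm_comp u v) (dm_id X) &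
                        dm_eq (dm_comp v u) (dm_id Y).

Definition isomorphic X Y : Prop := exists u : dmor X Y, dm_iso u.

Fixpoint dm_shift X Y (u : dmor X Y) : dmor (shift X) (shift Y) :=
  match u with
  | dm_of _ _ f => dm_of (cm_shift f)
  | dm_inv _ _ _ hs => dm_inv (quasi_iso_shift hs)
  | dm_comp _ _ _ u v => dm_comp (dm_shift u) (dm_shift v)
  end.

(* A triangle is distinguished when it is isomorphic in [D(R)] to the
   triangle of the mapping cone of a chain map. *)
Definition distinguished X Y Z (u : dmor X Y) (v : dmor Y Z)
    (w : dmor Z (shift X)) : Prop :=
  exists (X' Y' : complex R) (f : chain_map X' Y')
         (a : dmor X X') (b : dmor Y Y') (c : dmor Z (cone f)),
    [/\ dm_iso a, dm_iso b & dm_iso c] /\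
    [/\ dm_eq (dm_comp u b) (dm_comp a (dm_of f)),
        dm_eq (dm_comp v c) (dm_comp b (dm_of (cone_in f))) &
        dm_eq (dm_comp w (dm_shift a)) (dm_comp c (dm_of (cone_out f)))].

Definition is_coproduct (I : Type) (X : I -> complex R) (C : complex R)
    (j : forall i, dmor (X i) C) : Prop :=
  forall (Z : complex R) (g : forall i, dmor (X i) Z),
    exists2 h : dmor C Z, forall i, dm_eq (dm_comp (j i) h) (g i) &
      forall h' : dmor C Z, (forall i, dm_eq (dm_comp (j i) h') (g i)) ->
        dm_eq h' h.

(* Full subcategories of [D(R)] are given by their classes of objects.  In
   [loc_shift], the right-to-left implication is closure under the shift, and
   the converse is closure under its inverse. *)
Record localising (L : complex R -> Prop) : Prop := Localising {
  loc_iso : forall X Y, isomorphic X Y -> L X -> L Y;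
  loc_zero : L (cx_zero R);
  loc_shift : forall X, L (shift X) <-> L X;
  loc_cone : forall X Y Z (u : dmor X Y) (v : dmor Y Z) (w : dmor Z (shift X)),
    distinguished u v w -> L X -> L Y -> L Z;
  loc_coprod : forall (I : Type) (X : I -> complex R) (C : complex R)
      (j : forall i, dmor (X i) C),
    is_coproduct j -> (forall i, L (X i)) -> L C
}.

Definition bousfield_class (L : complex R -> Prop) : Prop :=
  exists X : complex R,
    forall Y : complex R, L Y <-> isomorphic (tensor_cx X Y) (cx_zero R).

End Derived.

(* Main.v *)
Require Import Defs.
From HB Require Import structures.
From mathcomp Require Import all_boot all_order all_algebra.
From mathcomp Require Import boolp classical_sets functions cardinality fsbigop.
From Stdlib Require Import Setoid Morphisms.

Set Implicit Arguments.
Unset Strict Implicit.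
Unset Printing Implicit Defensive.

Import GRing.Theory.
Local Open Scope ring_scope.

(** Let [M] be a nonzero quotient of [R] without simple submodules.  Call a set
    [J] of scalars dense when no nonzero element of [M] is annihilated by [J].
    Dense sets form a Gabriel filter ([denseS], [dense_trans]), so that the
    modules all of whose elements have a dense annihilator form a torsion class
    closed under submodules, quotients, extensions and direct sums.  Hence the
    complexes with torsion cohomology form a localising subcategory [L]
    ([homology_torsion_localising]).  Its members are recognised elementwise:
    the scalars that turn a given cycle into a boundary must be dense.

    A maximal ideal [m] is dense, because a nonzero element of [M] killed by
    [m] would span a copy of the simple module [R/m] ([maximal_dense]).  So [L]
    contains a complex with cohomology [R/m] for every [m], while it does not
    contain [R], whose annihilator is [0] and is not dense as [M] is nonzero.

    Suppose that [L] is the class of all [Y] with [X ⊗ Y] acyclic.  Given a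
    cycle of [X ⊗ R], the scalars that make it a boundary form an ideal [I].
    As [X ⊗ R/m] is acyclic, [I] meets [1 + m]: this is where absolute flatness
    enters, each element [y] of [m] being fixed by some element of [m], so that
    finitely many elements of [m] are killed by a single [1 - a] with [a] in
    [m] ([residue_acyclic_local]).  So [I] lies in no maximal ideal, and
    [X ⊗ R] is acyclic; but then [R] is in [L], a contradiction.

    Coproducts in [D(R)] are given by a universal property among formal
    zigzags of chain maps, so closure of [L] under them needs some calculus of
    fractions.  After replacing the summands by isomorphic objects, the legs of
    a coproduct [C] become chain maps ([roof]), hence assemble into one map
    from the direct sum to [C].  The map from [C] to the cone of that map
    vanishes on every leg, so it is zero by uniqueness, and the cohomology of
    [C] is a quotient of that of the direct sum ([coproduct_homology]). *)

(** * Submodules and linear maps *)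

Lemma linear_ext (R : comPzRingType) (U V : lmodType R)
    (f g : {linear U -> V}) : f =1 g -> f = g.
Proof.
case: f g => f [f1 f2] [g [g1 g2]] /= /funext fg; subst g.
have -> : f1 = g1.
  by case: f1 => p; case: g1 => q; congr (_ _); apply: Prop_irrelevance.
have -> : f2 = g2.
  by case: f2 => p; case: g2 => q; congr (_ _); apply: Prop_irrelevance.
by [].
Qed.

Lemma chain_map_ext (R : comPzRingType) (X Y : complex R)
    (f g : chain_map X Y) : (forall i, f i =1 g i) -> f = g.
Proof.
case: f g => f fc [g gc] /= fg.
have {}fg : f = g.
  apply: functional_extensionality_dep => i; apply/linear_ext/fg.
by subst g; congr ChainMap; apply: Prop_irrelevance.
Qed.

Section Submodule.
Variables (R : comPzRingType) (M : lmodType R) (S : {pred M}).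
Hypothesis hS : GRing.submod_closed S.

Definition submod_pred of GRing.submod_closed S : {pred M} := S.
HB.instance Definition _ := GRing.isSubmodClosed.Build R M (submod_pred hS)
  (GRing.submod_closed_semi hS).
Definition submod : Type := {x : M | submod_pred hS x}.
HB.instance Definition _ := SubChoice.on submod.
HB.instance Definition _ := [SubChoice_isSubLmodule of submod by <:].

Definition submod_in (x : M) (Sx : S x) : submod := exist _ x Sx.

End Submodule.

(** * Cohomology of the morphisms of the derived category *)

Section Boundaries.
Variables (R : comPzRingType) (X : complex R) (i : int).
Implicit Types x y : X (i + 1).

Lemma is_boundary0 : @is_boundary R X i 0.
Proof. by exists 0; rewrite linear0. Qed.

Lemma is_boundaryD x y : is_boundary x -> is_boundary y -> is_boundary (x + y).
Proof. by move=> [a <-] [b <-]; exists (a + b); rewrite linearD. Qed.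

Lemma is_boundaryZ r x : is_boundary x -> is_boundary (r *: x).
Proof. by move=> [a <-]; exists (r *: a); rewrite linearZ. Qed.

Lemma is_boundaryN x : is_boundary x -> is_boundary (- x).
Proof. by move=> [a <-]; exists (- a); rewrite linearN. Qed.

Lemma is_boundaryB x y : is_boundary x -> is_boundary y -> is_boundary (x - y).
Proof. by move=> bx /is_boundaryN; apply: is_boundaryD. Qed.

Lemma is_boundary_sub x y :
  is_boundary (x - y) -> is_boundary x <-> is_boundary y.
Proof.
move=> bxy; split=> b; last by rewrite -(subrK y x); apply: is_boundaryD.
by rewrite -(subKr x y); apply: is_boundaryB.
Qed.

Lemma is_boundary_subC x y : is_boundary (x - y) -> is_boundary (y - x).
Proof. by move=> /is_boundaryN; rewrite opprB. Qed.

Lemma is_boundary_trans y x z :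
  is_boundary (x - y) -> is_boundary (y - z) -> is_boundary (x - z).
Proof. by move=> b c; rewrite -(subrKA y); apply: is_boundaryD. Qed.

Lemma is_cycleB x y : is_cycle x -> is_cycle y -> is_cycle (x - y).
Proof. by rewrite /is_cycle linearB => -> ->; rewrite subrr. Qed.

Lemma is_cycleZ r x : is_cycle x -> is_cycle (r *: x).
Proof. by rewrite /is_cycle linearZ => /= ->; rewrite scaler0. Qed.
End Boundaries.

Section ChainMapHomology.
Variables (R : comPzRingType) (X Y : complex R) (f : chain_map X Y) (i : int).

Lemma chain_map_cycle (x : X (i + 1)) : is_cycle x -> is_cycle (f _ x).
Proof. by rewrite /is_cycle -cm_comm => ->; rewrite linear0. Qed.

Lemma chain_map_boundary (x : X (i + 1)) :
  is_boundary x -> is_boundary (f _ x).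
Proof. by move=> [y <-]; exists (f _ y); rewrite cm_comm. Qed.
End ChainMapHomology.

(** Cycles and boundaries live in degrees of the form [i + 1]; an arbitrary
    degree has to be put in this form before its cohomology can be used. *)
Lemma int_succ_ind (P : int -> Prop) : (forall i, P (i + 1)) -> forall i, P i.
Proof. by move=> PS i; rewrite -(subrK 1 i). Qed.

Section HomologyRelation.
Variable R : comPzRingType.
Implicit Types X Y Z : complex R.

(** The map that a formal zigzag induces on cohomology, as a relation between
    representatives; an inverted quasi-isomorphism gives the converse relation,
    so that no inverse has to be chosen. *)
Fixpoint hrel X Y (u : dmor X Y) i : X (i + 1) -> Y (i + 1) -> Prop :=
  match u in dmor X Y return X (i + 1) -> Y (i + 1) -> Prop with
  | dm_of _ _ f => fun x y =>
      [/\ is_cycle x, is_cycle y & is_boundary (y - f _ x)]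
  | dm_inv _ _ s _ => fun y x =>
      [/\ is_cycle y, is_cycle x & is_boundary (y - s _ x)]
  | dm_comp _ _ _ u v => fun x z => exists2 y, hrel u x y & hrel v y z
  end.

Lemma hrel_cycle X Y (u : dmor X Y) i (x : X (i + 1)) (y : Y (i + 1)) :
  hrel u x y -> is_cycle x /\ is_cycle y.
Proof.
elim: u x y => {X Y} [X Y f|X Y s hs|X Y Z u IHu v IHv] x y /= => [[]|[]|] //.
by move=> [z /IHu[cx _] /IHv[_ cy]].
Qed.

Lemma hrel_sub X Y (u : dmor X Y) i (x x' : X (i + 1)) (y y' : Y (i + 1)) :
  is_cycle x' -> is_cycle y' -> is_boundary (x' - x) -> is_boundary (y' - y) ->
  hrel u x y -> hrel u x' y'.
Proof.
elim: u x x' y y' => {X Y} [X Y f|X Y s hs|X Y Z u IHu v IHv]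
  x x' y y' cx' cy' bx by_ /=.
- move=> [cx cy b]; split=> //; apply: (is_boundary_trans by_).
  apply: (is_boundary_trans b); rewrite -linearB; apply: chain_map_boundary.
  exact: is_boundary_subC.
- move=> [cx cy b]; split=> //; apply: (is_boundary_trans bx).
  apply: (is_boundary_trans b); rewrite -linearB; apply: chain_map_boundary.
  exact: is_boundary_subC.
- move=> [z ux vz]; have [_ cz] := hrel_cycle ux.
  have bz : is_boundary (z - z) by rewrite subrr; apply: is_boundary0.
  by exists z; [apply: IHu ux|apply: IHv vz].
Qed.

Lemma hrel_total X Y (u : dmor X Y) i (x : X (i + 1)) :
  is_cycle x -> exists y, hrel u x y.
Proof.
elim: u x => {X Y} [X Y f|X Y s hs|X Y Z u IHu v IHv] x cx /=.
- exists (f _ x); split=> //; first exact: chain_map_cycle.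
  by rewrite subrr; apply: is_boundary0.
- by have [_ /(_ _ cx) [y cy b]] := hs i; exists y.
- have [y uy] := IHu _ cx; have [_ cy] := hrel_cycle uy.
  by have [z vz] := IHv _ cy; exists z; exists y.
Qed.

Lemma hrelZ X Y (u : dmor X Y) i (x : X (i + 1)) (y : Y (i + 1)) r :
  hrel u x y -> hrel u (r *: x) (r *: y).
Proof.
elim: u x y => {X Y} [X Y f|X Y s hs|X Y Z u IHu v IHv] x y /=.
- move=> [cx cy b]; split; try exact: is_cycleZ.
  by rewrite linearZ -scalerBr; apply: is_boundaryZ.
- move=> [cx cy b]; split; try exact: is_cycleZ.
  by rewrite linearZ -scalerBr; apply: is_boundaryZ.
- by move=> [z ux vz]; exists (r *: z); [apply: IHu|apply: IHv].
Qed.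

Lemma hrel_boundary X Y (u : dmor X Y) i (x : X (i + 1)) (y : Y (i + 1)) :
  hrel u x y -> is_boundary x -> is_boundary y.
Proof.
elim: u x y => {X Y} [X Y f|X Y s hs|X Y Z u IHu v IHv] x y /=.
- move=> [_ _ b] bx; apply/(is_boundary_sub b).
  exact: chain_map_boundary.
- move=> [_ cy b] /(is_boundary_sub b).
  by have [inj _] := hs i; apply: inj.
- by move=> [z ux vz] /(IHu _ _ ux)/(IHv _ _ vz).
Qed.

(** Cohomology factors through the localisation: the relation is unchanged by
    each of the generating identities, the two for formal inverses being the
    injectivity and the surjectivity on cohomology of a quasi-isomorphism. *)
Lemma hrel_eq X Y (u v : dmor X Y) i (x : X (i + 1)) (y : Y (i + 1)) :
  dm_eq u v -> hrel u x y <-> hrel v x y.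
Proof.
have b0 Z (z : Z (i + 1)) : is_boundary (z - z).
  by rewrite subrr; apply: is_boundary0.
move=> uv; elim: uv x y => {X Y u v} //=.
- by move=> X Y u v _ IH x y; split=> /IH.
- by move=> X Y u v w _ IH1 _ IH2 x y; split=> [/IH1/IH2|/IH2/IH1].
- move=> X Y Z u u' v v' _ IHu _ IHv x y.
  by split=> -[z /IHu ux /IHv vz]; exists z.
- move=> X Y Z W u v w x y; split=> [[z ux [t vz wt]]|[t [z ux vz] wt]].
    by exists t => //; exists z.
  by exists z => //; exists t.
- move=> X Y u x y; split=> [[z [cx cz b] uz]|ux].
    have [_ cy] := hrel_cycle uz.
    by apply: hrel_sub uz => //; apply: is_boundary_subC.
  by have [cx cy] := hrel_cycle ux; exists x.
- move=> X Y u x y; split=> [[z uz [cz cy b]]|ux].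
    have [cx _] := hrel_cycle uz.
    by apply: hrel_sub uz.
  by have [cx cy] := hrel_cycle ux; exists y.
- move=> X Y Z f g x z; split=> [[y [cx cy b] [_ cz c]]|[cx cz b]].
    split=> //; apply: (is_boundary_trans c); rewrite -linearB.
    exact: chain_map_boundary.
  have cy := chain_map_cycle f cx.
  by exists (f _ x).
- move=> X Y s hs x y; split=> [[z [cx cz b] [_ cy c]]|[cx cy b]].
    split=> //; have [inj _] := hs i; apply: inj; first exact: is_cycleB.
    rewrite linearB; apply: is_boundary_trans b; exact: is_boundary_subC.
  exists (s _ x); first by split=> //; apply: chain_map_cycle.
  split=> //; first exact: chain_map_cycle.
  by rewrite -linearB; apply: chain_map_boundary; apply: is_boundary_subC.
- move=> X Y s hs x y; split=> [[z [cx cz b] [_ cy c]]|[cx cy b]].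
    split=> //; apply: (is_boundary_trans c); exact: is_boundary_subC.
  have [_ /(_ _ cx) [z cz c]] := hs i; exists z => //; split=> //.
  exact: is_boundary_trans c.
Qed.

Lemma isomorphic_sym X Y : isomorphic X Y -> isomorphic Y X.
Proof. by move=> [u [v uv vu]]; exists v; exists u. Qed.

(** All that is used of the invariance of cohomology under isomorphism: the
    element corresponding to the class of [y] has at most its annihilator. *)
Lemma isomorphic_cycle X Y : isomorphic X Y ->
  forall i (y : Y (i + 1)), is_cycle y -> exists2 x : X (i + 1), is_cycle x &
    forall r, is_boundary (r *: x) -> is_boundary (r *: y).
Proof.
move=> [u [v _ vu]] i y cy.
have [x vy] := hrel_total v cy; have [_ cx] := hrel_cycle vy.
have [y' ux] := hrel_total u cx; exists x => // r /(hrel_boundary (hrelZ r ux)).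
have /(hrel_eq _ _ vu) [_ _] : hrel (dm_comp v u) y y' by exists x.
move=> /(is_boundaryZ r); rewrite scalerBr => b by'; exact/(is_boundary_sub b).
Qed.

Definition acyclic X := forall i (x : X (i + 1)), is_cycle x -> is_boundary x.

Lemma acyclic_iso0 X : isomorphic X (cx_zero R) -> acyclic X.
Proof.
move=> /isomorphic_sym iX i x cx; have [z _ bz] := isomorphic_cycle iX cx.
rewrite -[x]scale1r; apply: bz; rewrite (_ : z = 0) ?scaler0; last first.
  by apply/rowP; case.
exact: is_boundary0.
Qed.

Lemma isomorphic_qi X Y (s : chain_map X Y) : quasi_iso s -> dm_iso (dm_of s).
Proof.
by move=> hs; exists (dm_inv hs); [apply: dm_invr|apply: dm_invl].
Qed.

Program Definition cm_zero X Y : chain_map X Y := @ChainMap R X Y (fun=> \0) _.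
Next Obligation. by rewrite /= linear0. Qed.

Lemma acyclic_qi0 X : acyclic X -> quasi_iso (cm_zero X (cx_zero R)).
Proof.
move=> aX i; split=> [x cx _|y cy]; first exact: aX.
exists 0; first by rewrite /is_cycle linear0.
by rewrite (_ : y - _ = 0); [apply: is_boundary0|apply/rowP; case].
Qed.

Lemma iso0_acyclic X : acyclic X -> isomorphic X (cx_zero R).
Proof. by move=> /acyclic_qi0/isomorphic_qi iX; eexists; exact: iX. Qed.
End HomologyRelation.

(** * Replacing quasi-isomorphisms by surjective ones *)

Section DirectSumTheory.
Variables (R : comPzRingType) (I : choiceType) (M : I -> lmodType R).

Lemma dsum_in_same i (x : M i) : dsum_in x i = x.
Proof.
rewrite /= /dsum_in_fun; case: pselect => // e.
by rewrite (Prop_irrelevance e erefl).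
Qed.

Lemma dsum_in_other i j (x : M i) : i <> j -> dsum_in x j = 0.
Proof. by rewrite /= /dsum_in_fun; case: pselect. Qed.

Lemma dsum_ind_in (Q : dsum M -> Prop) :
  (forall u v, Q u -> Q v -> Q (u + v)) -> Q 0 ->
  (forall i (x : M i), Q (dsum_in x)) -> forall u, Q u.
Proof. by move=> QD Q0 Qin u; rewrite -(dsum_sum u); apply: big_ind. Qed.
End DirectSumTheory.

Section ProductComplex.
Variables (R : comPzRingType) (X Y : complex R).

Definition prod_obj i : lmodType R := (X i * Y i)%type.

Definition prod_d_fun i (p : prod_obj i) : prod_obj (i + 1) :=
  (cx_d X i p.1, cx_d Y i p.2).
Fact prod_d_linear i : linear (@prod_d_fun i).
Proof. by move=> a p q; congr (_, _); rewrite /= linearP. Qed.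
HB.instance Definition _ i :=
  GRing.isLinear.Build R _ _ *:%R (@prod_d_fun i) (@prod_d_linear i).
Definition prod_d i : {linear prod_obj i -> prod_obj (i + 1)} := @prod_d_fun i.

Fact prod_dd i p : prod_d (i + 1) (prod_d i p) = 0.
Proof. by congr (_, _); rewrite /= cx_dd. Qed.

Definition prod_cx : complex R := Complex prod_dd.

Program Definition prod_fst : chain_map prod_cx X :=
  @ChainMap R prod_cx X (fun i => fst) _.

Definition prod_inl_fun i (x : X i) : prod_obj i := (x, 0).
Fact prod_inl_linear i : linear (@prod_inl_fun i).
Proof. by move=> a x y; congr (_, _); rewrite /= scaler0 addr0. Qed.
HB.instance Definition _ i :=
  GRing.isLinear.Build R _ _ *:%R (@prod_inl_fun i) (@prod_inl_linear i).
Program Definition prod_inl : chain_map X prod_cx :=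
  @ChainMap R X prod_cx (fun i => @prod_inl_fun i) _.
Next Obligation. by rewrite /= /prod_d_fun /prod_inl_fun /= linear0. Qed.

Variables (Z : complex R) (f : chain_map X Z) (g : chain_map Y Z).
Definition prod_lift_fun i (p : prod_obj i) : Z i := f i p.1 + g i p.2.
Fact prod_lift_linear i : linear (@prod_lift_fun i).
Proof.
by move=> a p q; rewrite /prod_lift_fun /= !linearP scalerDr addrACA.
Qed.
HB.instance Definition _ i :=
  GRing.isLinear.Build R _ _ *:%R (@prod_lift_fun i) (@prod_lift_linear i).
Program Definition prod_lift : chain_map prod_cx Z :=
  @ChainMap R prod_cx Z (fun i => @prod_lift_fun i) _.
Next Obligation. by rewrite /= /prod_lift_fun /= !cm_comm linearD. Qed.

Hypothesis aY : acyclic Y.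

Lemma prod_inl_qi : quasi_iso prod_inl.
Proof.
move=> i; split=> [x cx [[x' y'] [e _]]|[x y] [cx /aY[y' e]]].
  by exists x'.
exists x => //; exists (0, y'); congr (_, _); rewrite /= ?linear0 ?subrr //.
by rewrite e addr0.
Qed.

Lemma prod_lift_qi : quasi_iso f -> quasi_iso prod_lift.
Proof.
move=> fq i; have [finj fsurj] := fq i; split=> [[x y] [cx cy] b|z cz].
  have [y' ey] := aY cy.
  have [x' ex] : is_boundary x.
    apply: finj => //; move: b; rewrite /= /prod_lift_fun /= -ey cm_comm => b.
    rewrite -[X in is_boundary X](addrK (cx_d Z i (g i y'))).
    by apply: is_boundaryB => //; exists (g i y').
  by exists (x', y'); congr (_, _).
have [x cx b] := fsurj z cz; exists (x, 0).
  by congr (_, _); rewrite /= ?linear0.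
by rewrite /= /prod_lift_fun /= linear0 addr0.
Qed.
End ProductComplex.

(** Every complex [Y] receives a surjection from an acyclic one.  The usual
    choice, the cone of the identity shifted back, would have [Y (i - 1)] in
    degree [i] and so casts along [i - 1 + 1 = i].  These are avoided by putting
    [G * G] in every degree, where [G] is the direct sum of all the [Y k]; its
    differential [(a, b) |-> (b, 0)] is exact. *)
Section AcyclicCover.
Variables (R : comPzRingType) (Y : complex R).

Let G := dsum (fun k : int => Y k).

Definition total_d : {linear G -> G} :=
  dsum_lift (fun k : int => @dsum_in R int (fun k => Y k) (k + 1) \o cx_d Y k
    : {linear Y k -> G}).

Lemma total_dE (u : G) k : total_d u (k + 1) = cx_d Y k (u k).
Proof.
elim/dsum_ind_in: u => [u v IHu IHv||j y].
- by rewrite linearD /= linearD -IHu -IHv.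
- by rewrite !linear0.
have -> : total_d (dsum_in y) = @dsum_in R int (fun k => Y k) _ (cx_d Y j y).
  by rewrite /total_d /= dsum_lift_in.
have [<-|jk] := pselect (j = k); first by rewrite !dsum_in_same.
rewrite !dsum_in_other ?linear0 //; by move=> /addIr.
Qed.

Lemma total_dd (u : G) : total_d (total_d u) = 0.
Proof.
by apply: dsum_ext => k; elim/int_succ_ind: k => k; rewrite total_dE;
   elim/int_succ_ind: k => k; rewrite total_dE cx_dd.
Qed.

Definition cover_d_fun (p : G * G) : G * G := (p.2, 0).
Fact cover_d_linear : linear cover_d_fun.
Proof. by move=> a p q; congr (_, _); rewrite /= scaler0 addr0. Qed.
HB.instance Definition _ :=
  GRing.isLinear.Build R _ _ *:%R cover_d_fun cover_d_linear.

Fact cover_dd (i : int) p : cover_d_fun (cover_d_fun p) = 0.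
Proof. by []. Qed.

Definition cover_cx : complex R :=
  @Complex R (fun=> (G * G)%type) (fun=> cover_d_fun) cover_dd.

Lemma cover_acyclic : acyclic cover_cx.
Proof. by move=> i [a b] [/= e]; exists (0, a); rewrite e. Qed.

(** The second summand makes the map surjective; compatibility with the
    differentials then forces the first one. *)
Definition cover_map_fun i (p : cover_cx i) : Y i := (total_d p.1 + p.2) i.
Fact cover_map_linear i : linear (@cover_map_fun i).
Proof.
by move=> a p q; rewrite /cover_map_fun /= linearP /= scalerDr addrACA.
Qed.
HB.instance Definition _ i :=
  GRing.isLinear.Build R _ _ *:%R (@cover_map_fun i) (@cover_map_linear i).
Program Definition cover_map : chain_map cover_cx Y :=
  @ChainMap R cover_cx Y (fun i => @cover_map_fun i) _.
Next Obligation.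
rewrite /= /cover_map_fun /= addr0 total_dE linearD /=.
by rewrite -[X in _ = X + _]total_dE total_dd add0r.
Qed.

Lemma cover_map_surj i (y : Y i) : exists p, cover_map i p = y.
Proof.
exists (0, @dsum_in R int (fun k => Y k) i y).
by rewrite /= /cover_map_fun linear0 add0r; apply: dsum_in_same.
Qed.
End AcyclicCover.

Section Pullback.
Variables (R : comPzRingType) (X Y Z : complex R).
Variables (f : chain_map X Z) (t : chain_map Y Z).

Definition pb_pred i : {pred (X i * Y i)%type} := [pred p | f i p.1 == t i p.2].

Fact pb_closed i : GRing.submod_closed (@pb_pred i).
Proof.
split=> [|a p q]; rewrite !inE /= ?linear0 // => /eqP pP /eqP qP.
by rewrite !linearP pP qP.
Qed.

Definition pb_obj i : lmodType R := submod (pb_closed i).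

Lemma pb_objP i (p : pb_obj i) : f i (val p).1 = t i (val p).2.
Proof. exact/eqP/(valP p). Qed.

Fact pb_d_subproof i (p : pb_obj i) :
  @pb_pred (i + 1) (cx_d X i (val p).1, cx_d Y i (val p).2).
Proof. by apply/eqP; rewrite !cm_comm /= pb_objP. Qed.
Definition pb_d_fun i (p : pb_obj i) : pb_obj (i + 1) :=
  submod_in (pb_closed (i + 1)) (pb_d_subproof p).
Fact pb_d_linear i : linear (@pb_d_fun i).
Proof.
move=> a p q; apply: val_inj; by congr (_, _); rewrite /= linearP.
Qed.
HB.instance Definition _ i :=
  GRing.isLinear.Build R _ _ *:%R (@pb_d_fun i) (@pb_d_linear i).
Definition pb_d i : {linear pb_obj i -> pb_obj (i + 1)} := @pb_d_fun i.
Fact pb_dd i p : pb_d (i + 1) (pb_d i p) = 0.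
Proof. by apply: val_inj; congr (_, _); rewrite /= cx_dd. Qed.

Definition pb_cx : complex R := Complex pb_dd.

Program Definition pb_fst : chain_map pb_cx X :=
  @ChainMap R pb_cx X (fun i => fst \o val) _.
Program Definition pb_snd : chain_map pb_cx Y :=
  @ChainMap R pb_cx Y (fun i => snd \o val) _.

Lemma pb_elt i (x : X i) (y : Y i) : f i x = t i y ->
  exists p : pb_cx i, val p = (x, y).
Proof. by move=> /eqP e; exists (@submod_in _ _ _ (pb_closed i) (x, y) e). Qed.

(** Surjectivity lets a boundary in [Z] be corrected by the image of an element
    of [Y], which is how cycles of [Y] matching [f x] up to a boundary become
    elements of the strict pullback. *)
Lemma pb_fst_qi : quasi_iso t -> (forall i (z : Z i), exists y, t i y = z) ->
  quasi_iso pb_fst.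
Proof.
move=> tq ts; elim/int_succ_ind => i; have [tinj tsurj] := tq (i + 1).
split=> [p cp [x ex]|x cx].
  have {}ex : cx_d X _ x = (val p).1 := ex.
  have fty := pb_objP p; have /= [_ cy] := congr1 val cp.
  (* [y0] bounds the second component, but [(x, y0)] need not be in the
     pullback: the defect is a cycle, which lifts to [Y] up to a boundary. *)
  have [y0 ey0] : is_boundary (val p).2.
    by apply: tinj => //; rewrite -fty -ex cm_comm; exists (f _ x).
  have [_ tsurj'] := tq i; have [|y1 cy1 [z ez]] := tsurj' (f _ x - t _ y0).
    by rewrite /is_cycle linearB -!cm_comm ey0 ex /= fty subrr.
  have [y2 ey2] := ts _ z.
  have [q eq] : exists q : pb_cx (i + 1), val q = (x, y0 + y1 + cx_d Y _ y2).
    apply: pb_elt; rewrite !linearD /= cm_comm ey2 ez.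
    by rewrite -[X in _ = _ + X]addrA -opprD [RHS]addrC subrK.
  exists q; apply: val_inj; rewrite [LHS]/= eq /= !linearD /= cx_dd cy1 ey0 ex.
  by rewrite !addr0 -surjective_pairing.
have [y cy [z ez]] := tsurj _ (chain_map_cycle f cx).
have [y' ey'] := ts _ z.
have [p ep] : exists p : pb_cx (i + 1 + 1), val p = (x, y + cx_d Y _ y').
  by apply: pb_elt; rewrite linearD cm_comm ey' ez [RHS]addrC subrK.
exists p; last by rewrite /= ep subrr; apply: is_boundary0.
by apply: val_inj; congr (_, _); rewrite /= ep //= linearD cy cx_dd addr0.
Qed.
End Pullback.

(** * Fractions and coproducts in the derived category *)

Section DerivedCalculus.
Variable R : comPzRingType.
Implicit Types X Y Z W : complex R.

#[local] Hint Resolve dm_refl : core.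
#[local] Instance dm_eq_equiv X Y : Equivalence (@dm_eq R X Y).
Proof.
by split=> [u|u v|u v w]; [apply: dm_refl|apply: dm_sym|apply: dm_trans].
Qed.
#[local] Instance dm_comp_proper X Y Z :
  Proper (@dm_eq R X Y ==> @dm_eq R Y Z ==> @dm_eq R X Z) (@dm_comp R X Y Z).
Proof. by move=> u u' uu' v v'; apply: dm_congr. Qed.

Lemma dm_iso_comp X Y Z (u : dmor X Y) (v : dmor Y Z) :
  dm_iso u -> dm_iso v -> dm_iso (dm_comp u v).
Proof.
move=> [u' uu' u'u] [v' vv' v'v]; exists (dm_comp v' u').
  by rewrite dm_assoc -(dm_assoc u) vv' dm_idr.
by rewrite dm_assoc -(dm_assoc v') u'u dm_idr.
Qed.

Lemma dm_iso_id X : dm_iso (dm_id X).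
Proof. by exists (dm_id X); exact (dm_idl (dm_id X)). Qed.

Lemma dm_iso_cancel X Y Z (s : dmor X Y) (u v : dmor Y Z) : dm_iso s ->
  dm_eq (dm_comp s u) (dm_comp s v) -> dm_eq u v.
Proof.
move=> [s' _ s's] e; rewrite -(dm_idl u) -(dm_idl v) -s's.
by rewrite -!dm_assoc e.
Qed.

(** An acyclic complex is a zero object of the derived category, so both maps
    factor there through zero. *)
Lemma acyclic_factor_eq0 X A Y (a : chain_map X A) (b : chain_map A Y) :
  acyclic A -> dm_eq (dm_of (cm_comp b a)) (dm_of (cm_zero X Y)).
Proof.
move=> aA; have zq := acyclic_qi0 aA.
have <- : cm_comp (cm_comp (cm_zero (cx_zero R) Y) (cm_zero A _)) a =
    cm_zero X Y.
  by apply: chain_map_ext.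
rewrite -!dm_of_comp.
suff <- : dm_eq (dm_of (cm_comp b (cm_zero (cx_zero R) A)))
                (dm_of (cm_zero (cx_zero R) Y)).
  rewrite -dm_of_comp (dm_assoc (dm_of (cm_zero A _))).
  suff -> : dm_eq (dm_comp (dm_of (cm_zero A _))
                           (dm_of (cm_zero (cx_zero R) A))) (dm_id A).
    by rewrite dm_idl.
  suff -> : dm_eq (dm_of (cm_zero (cx_zero R) A)) (dm_inv zq) by apply: dm_invr.
  rewrite -[X in dm_eq X _]dm_idr -(dm_invr zq) dm_assoc dm_of_comp.
  rewrite (_ : cm_comp _ _ = cm_id _) ?dm_idl //.
  by apply: chain_map_ext => i x; apply/rowP; case.
rewrite (_ : cm_comp b _ = cm_zero _ Y) //; apply: chain_map_ext => i x.
by rewrite /= linear0.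
Qed.

(** One half of a calculus of right fractions: the denominator [s] is only
    asked to be invertible in the derived category.  Carrying the chain map [f]
    in front of the zigzag makes the induction go through composites.  For a
    formal inverse of [t], the pullback of [f] along [t] is taken after
    making [t] surjective. *)
Lemma roof Y Z (u : dmor Y Z) X (f : chain_map X Y) :
  exists X' (s : dmor X' X) (g : chain_map X' Z),
    dm_iso s /\ dm_eq (dm_comp s (dm_comp (dm_of f) u)) (dm_of g).
Proof.
elim: u X f => {Y Z} [Y Z g|Z Y t tq|Y Y' Z u IHu v IHv] X f.
- exists X, (dm_id X), (cm_comp g f); split; first exact: dm_iso_id.
  by rewrite dm_idl dm_of_comp.
- pose t' := prod_lift t (cover_map Y).
  have aC := @cover_acyclic R Y.
  have t'q : quasi_iso t' := prod_lift_qi (cover_map Y) aC tq.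
  have t's i (y : Y i) : exists p, t' i p = y.
    have [p ep] := cover_map_surj y; exists (0, p).
    by rewrite /= /prod_lift_fun /= linear0 add0r.
  (* [prod_fst] is inverse to [prod_inl] in the derived category. *)
  have pt : dm_eq (dm_comp (dm_of (prod_fst Z (cover_cx Y))) (dm_of t))
                  (dm_of t').
    have iq := isomorphic_qi (prod_inl_qi Z aC).
    apply: (dm_iso_cancel iq); rewrite dm_assoc !dm_of_comp.
    rewrite (_ : cm_comp _ _ = cm_id Z); last exact: chain_map_ext.
    rewrite (_ : cm_comp t _ = cm_comp t' (prod_inl _ _)) //.
    apply: chain_map_ext => i z.
    by rewrite /= /prod_lift_fun /= linear0 addr0.
  exists (pb_cx f t'), (dm_of (pb_fst f t')).
  exists (cm_comp (prod_fst _ _) (pb_snd f t')); split.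
    exact/isomorphic_qi/pb_fst_qi.
  rewrite dm_assoc dm_of_comp (_ : cm_comp f _ = cm_comp t' (pb_snd f t')).
    by rewrite -!dm_of_comp -pt -!dm_assoc dm_invr dm_idr.
  by apply: chain_map_ext => i p; apply: pb_objP.
- have [X1 [s1 [g1 [is1 e1]]]] := IHu _ f.
  have [X2 [s2 [g2 [is2 e2]]]] := IHv _ g1.
  exists X2, (dm_comp s2 s1), g2; split; first exact: dm_iso_comp.
  by rewrite -e2 -e1 -!dm_assoc.
Qed.
End DerivedCalculus.

Section DirectSumComplex.
Variables (R : comPzRingType) (I : choiceType) (X : I -> complex R).

(** Named so that unification finds the linear structure of [dsum_in]. *)
Definition dsum_family (n : int) (k : I) : lmodType R := X k n.
Definition dsum_obj (n : int) : lmodType R := dsum (dsum_family n).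

Fact dsum_d_fin n (u : dsum_obj n) :
  finite_set [set k | cx_d (X k) n (u k) <> 0]%classic.
Proof.
apply: (sub_finite_set _ (dsum_fin u)) => k /= h u0.
by apply: h; rewrite u0 linear0.
Qed.
Definition dsum_d_fun n (u : dsum_obj n) : dsum_obj (n + 1) :=
  DSum (dsum_d_fin u).
Fact dsum_d_linear n : linear (@dsum_d_fun n).
Proof. by move=> a u v; apply: dsum_ext => k; rewrite /= linearP. Qed.
HB.instance Definition _ n :=
  GRing.isLinear.Build R _ _ *:%R (@dsum_d_fun n) (@dsum_d_linear n).
Definition dsum_d n : {linear dsum_obj n -> dsum_obj (n + 1)} := @dsum_d_fun n.

Fact dsum_dd n u : dsum_d (n + 1) (dsum_d n u) = 0.
Proof. by apply: dsum_ext => k; rewrite /= cx_dd. Qed.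

Definition dsum_cx : complex R := Complex dsum_dd.

Let in_ k n : {linear dsum_family n k -> dsum (dsum_family n)} :=
  @dsum_in R I (dsum_family n) k.

Fact dsum_in_comm k n (x : X k n) :
  in_ k (n + 1) (cx_d (X k) n x) = cx_d dsum_cx n (in_ k n x).
Proof.
apply: dsum_ext => l; rewrite /= /dsum_in_fun; case: pselect => [e|_].
  by case: _ / e.
by rewrite linear0.
Qed.
Definition dsum_cx_in k : chain_map (X k) dsum_cx :=
  @ChainMap R (X k) dsum_cx (in_ k) (@dsum_in_comm k).

Variables (C : complex R) (f : forall k, chain_map (X k) C).

Let lift n : {linear dsum (dsum_family n) -> C n} :=
  @dsum_lift R I (dsum_family n) (C n) (fun k => f k n).

Fact dsum_lift_comm n (u : dsum_cx n) :
  lift (n + 1) (cx_d dsum_cx n u) = cx_d C n (lift n u).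
Proof.
elim/dsum_ind_in: u => [u v IHu IHv||k x].
- by rewrite !linearD IHu IHv.
- by rewrite !linear0.
rewrite -[dsum_in x]/(in_ k n x) -dsum_in_comm /lift /=.
by rewrite !dsum_lift_in cm_comm.
Qed.
Definition dsum_cx_lift : chain_map dsum_cx C :=
  @ChainMap R dsum_cx C lift dsum_lift_comm.

Lemma dsum_cx_liftK k : cm_comp dsum_cx_lift (dsum_cx_in k) = f k.
Proof. by apply: chain_map_ext => n x; rewrite /= dsum_lift_in. Qed.
End DirectSumComplex.

Section ConeZero.
Variables (R : comPzRingType) (X Y : complex R) (f : chain_map X Y).

Lemma cone_id_acyclic : acyclic (cone (cm_id X)).
Proof.
move=> i [x y] [/= _ e].
exists (y, 0); rewrite /= /cone_d_fun /=; congr (_, _).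
  by apply/eqP; rewrite eq_sym -subr_eq0 opprK; apply/eqP.
by rewrite linear0 addr0.
Qed.

Definition cone_map_fun i (p : cone (cm_id X) i) : cone f i := (p.1, f _ p.2).
Fact cone_map_linear i : linear (@cone_map_fun i).
Proof. by move=> a p q; congr (_, _); rewrite /= linearP. Qed.
HB.instance Definition _ i :=
  GRing.isLinear.Build R _ _ *:%R (@cone_map_fun i) (@cone_map_linear i).
Program Definition cone_map : chain_map (cone (cm_id X)) (cone f) :=
  @ChainMap R _ _ (fun i => @cone_map_fun i) _.
Next Obligation.
by rewrite /= /cone_d_fun /cone_map_fun /= linearD cm_comm.
Qed.

(** The composite factors through the acyclic cone of the identity of [X]. *)
Lemma cone_in_eq0 :
  dm_eq (dm_of (cm_comp (cone_in f) f)) (dm_of (cm_zero X (cone f))).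
Proof.
rewrite (_ : cm_comp _ _ = cm_comp cone_map (cone_in (cm_id X))).
  exact: acyclic_factor_eq0 cone_id_acyclic.
by apply: chain_map_ext => i x; rewrite /= /cone_map_fun.
Qed.
End ConeZero.

Section Coproducts.
Variable R : comPzRingType.
#[local] Hint Resolve dm_refl : core.
#[local] Existing Instances dm_eq_equiv dm_comp_proper.

(** Once the legs are chain maps, the cone of the induced map from the direct
    sum measures what is left of the cohomology of [C]; by the universal
    property [C] maps to it by zero. *)
Lemma coproduct_homology (I : choiceType) (X : I -> complex R) (C : complex R)
    (j : forall k, dmor (X k) C) : is_coproduct j ->
  exists2 X' : I -> complex R, forall k, isomorphic (X k) (X' k) &
    exists f : chain_map (dsum_cx X') C,
      forall i (c : C (i + 1)), is_cycle c ->
        exists2 p, is_cycle p & is_boundary (c - f (i + 1) p).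
Proof.
move=> jC.
have roofs k :
    exists t : {X' : complex R & (dmor X' (X k) * chain_map X' C)%type},
    dm_iso (projT2 t).1 /\
    dm_eq (dm_comp (projT2 t).1 (j k)) (dm_of (projT2 t).2).
  have [X' [s [g [is_ e]]]] := roof (j k) (cm_id (X k)).
  by exists (existT _ X' (s, g)); split => //=; rewrite -e dm_idl.
pose t k := projT1 (cid (roofs k)); have tP k := projT2 (cid (roofs k)).
pose X' k := projT1 (t k); pose s k : dmor (X' k) (X k) := (projT2 (t k)).1.
pose f k : chain_map (X' k) C := (projT2 (t k)).2.
exists X' => [k|]; first by apply: isomorphic_sym; exists (s k); case: (tP k).
pose F := dsum_cx_lift f; exists F => i c cc.
(* [cone_in F] and [0] agree on all the legs of the coproduct. *)
have k0 : dm_eq (dm_of (cone_in F)) (dm_of (cm_zero C (cone F))).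
  have [h _ h1] := jC _ (fun k => dm_comp (j k) (dm_of (cone_in F))).
  rewrite (h1 (dm_of (cone_in F))) //; symmetry; apply: h1 => k.
  have [isk ek] := tP k; apply: (dm_iso_cancel isk).
  rewrite !dm_assoc ek -/(f k) -(dsum_cx_liftK f k) -!dm_of_comp -!dm_assoc.
  rewrite (dm_of_comp _ (cone_in F)) cone_in_eq0 !dm_of_comp.
  rewrite (_ : cm_comp (cm_comp _ _) _ =
               cm_comp (cm_zero (dsum_cx X') (cone F)) (dsum_cx_in X' k)) //.
  exact: chain_map_ext.
have cin := chain_map_cycle (cone_in F) cc.
have /(hrel_eq _ _ k0) [_ _ [[p c'] e]] :
    hrel (dm_of (cone_in F)) c (cone_in F _ c).
  by split=> //; rewrite subrr; apply: is_boundary0.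
have ep : - cx_d (dsum_cx X') _ p = 0 - 0 := congr1 fst e.
have ec : F _ p + cx_d C i c' = c - 0 := congr1 snd e.
exists p; first by rewrite /is_cycle -[LHS]opprK ep subrr oppr0.
by exists c'; rewrite -(subr0 c) -ec [X in _ = X - _]addrC addrK.
Qed.
End Coproducts.

(** * Complexes with torsion cohomology *)

Section Torsion.
Variables (R : comPzRingType) (M : lmodType R).

Definition dense (J : R -> Prop) : Prop :=
  forall m : M, (forall a, J a -> a *: m = 0) -> m = 0.

Lemma denseS (J K : R -> Prop) : (forall a, J a -> K a) -> dense J -> dense K.
Proof. by move=> JK dJ m Km; apply: dJ => a /JK/Km. Qed.

Lemma dense_full (J : R -> Prop) : J 1 -> dense J.
Proof. by move=> J1 m /(_ _ J1); rewrite scale1r. Qed.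

(** Closure of torsion modules under extensions. *)
Lemma dense_trans (J K : R -> Prop) : dense J ->
  (forall a, J a -> dense (fun b => K (b * a))) -> dense K.
Proof.
move=> dJ dK m Km; apply: dJ => a /dK; apply=> b /Km.
by rewrite scalerA.
Qed.

Definition homology_torsion (X : complex R) : Prop :=
  forall i (x : X (i + 1)), is_cycle x -> dense (fun r => is_boundary (r *: x)).

Lemma homology_torsion_iso (X Y : complex R) :
  isomorphic X Y -> homology_torsion X -> homology_torsion Y.
Proof.
move=> XY tX i y cy; have [x cx xy] := isomorphic_cycle XY cy.
exact: denseS xy (tX i x cx).
Qed.

Lemma homology_torsion_shift (X : complex R) :
  homology_torsion (shift X) <-> homology_torsion X.
Proof.
have cycleE i (x : X (i + 1 + 1)) :
    @is_cycle R (shift X) i x <-> @is_cycle R X (i + 1) x.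
  rewrite /is_cycle /=; split=> [e|->]; last by rewrite oppr0.
  by rewrite -[LHS]opprK e oppr0.
have boundaryE i (x : X (i + 1 + 1)) :
    @is_boundary R (shift X) i x <-> @is_boundary R X (i + 1) x.
  by split=> -[y <-]; exists (- y); rewrite /= linearN ?opprK.
split=> tX.
  elim/int_succ_ind=> i x /cycleE cx.
  by apply: denseS (tX i x cx) => r /boundaryE.
move=> i x /cycleE cx; apply: denseS (tX _ x cx) => r.
by move=> b; apply/boundaryE.
Qed.

(** The long exact sequence, elementwise: if [r] makes the component of a cycle
    in [X] a boundary, then [r] times the cycle comes from [Y] up to a
    boundary. *)
Lemma homology_torsion_cone (X Y : complex R) (f : chain_map X Y) :
  homology_torsion X -> homology_torsion Y -> homology_torsion (cone f).
Proof.
move=> tX tY i [x y] e.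
have cx : is_cycle x.
  have ex : - cx_d X _ x = 0 := congr1 fst e.
  by rewrite /is_cycle -[LHS]opprK ex oppr0.
have cy : f _ x + cx_d Y _ y = 0 := congr1 snd e.
apply: dense_trans (tX _ x cx) _ => r [x0 ex0].
have cy' : is_cycle (r *: y + f _ x0).
  rewrite /is_cycle linearD linearZ /= -cm_comm ex0 linearZ /= -scalerDr.
  by rewrite [X in _ *: X]addrC cy scaler0.
apply: denseS (tY _ _ cy') => s [y1 ey1]; exists (- (s *: x0), y1).
congr (_, _); rewrite /= linearN linearZ /=.
  by rewrite opprK ex0 scalerA.
by rewrite ey1 scalerDr [X in _ + X = _]addrC addKr scalerA.
Qed.

Lemma homology_torsion_dsum (I : choiceType) (X : I -> complex R) :
  (forall k, homology_torsion (X k)) -> homology_torsion (dsum_cx X).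
Proof.
move=> tX i u cu.
pose A (v : dsum_cx X (i + 1)) := dense (fun r => is_boundary (r *: v)).
have AD v w : A v -> A w -> A (v + w).
  move=> dv dw; apply: dense_trans dv _ => r bv.
  apply: denseS dw => s bw; rewrite scalerDr; apply: is_boundaryD.
    by rewrite -scalerA; apply: is_boundaryZ.
  by rewrite mulrC -scalerA; apply: is_boundaryZ.
have A0 : A 0.
  by apply: dense_full; rewrite scaler0; apply: is_boundary0.
rewrite -/(A u) -(dsum_sum u); apply: big_ind => // k _.
have cuk : is_cycle (u k) := congr1 (fun v : dsum_cx X (i + 1 + 1) => v k) cu.
apply: denseS (tX k _ _ cuk) => r b.
have := chain_map_boundary (dsum_cx_in X k) b.
by rewrite linearZ.
Qed.

Lemma homology_torsion_localising : localising homology_torsion.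
Proof.
split.
- exact: homology_torsion_iso.
- move=> i x _; apply: dense_full; rewrite (_ : _ *: _ = 0); last first.
    by apply/rowP; case.
  exact: is_boundary0.
- exact: homology_torsion_shift.
- move=> X Y Z u v w [X' [Y' [f [a [b [c [[ia ib ic] _]]]]]]] tX tY.
  have iZ : isomorphic (cone f) Z by apply: isomorphic_sym; exists c.
  apply: (homology_torsion_iso iZ); apply: homology_torsion_cone.
    by apply: homology_torsion_iso tX; exists a.
  by apply: homology_torsion_iso tY; exists b.
- move=> I X C j jC tX.
  have [X' iX [f fsurj]] :=
    @coproduct_homology R {classic I} X C j jC.
  have tX' : homology_torsion (dsum_cx X').
    by apply: homology_torsion_dsum => k; apply: homology_torsion_iso (tX k).
  move=> i c cc; have [p cp b] := fsurj i c cc.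
  apply: denseS (tX' _ p cp) => r bp.
  apply/(is_boundary_sub (y := f _ (r *: p))); last exact: chain_map_boundary.
  by rewrite linearZ -scalerBr; apply: is_boundaryZ.
Qed.
End Torsion.

(** * Maximal ideals *)

Section MaximalIdeal.
Variable R : comPzRingType.

Lemma maximal_ideal (I : {pred R^o}) : GRing.submod_closed I -> 1 \notin I ->
  exists2 m : {pred R^o}, GRing.submod_closed m &
    [/\ {subset I <= m}, 1 \notin m &
        forall r, r \notin m -> exists a : R, 1 - a * r \in m].
Proof.
move=> [I0 IL] I1.
pose proper_ideal (B : set R) :=
  [/\ B 0, forall (a x y : R), B x -> B y -> B (a * x + y) & ~ B 1].
(* Zorn is applied to the sets whose union with [I] is a proper ideal, so that
   the empty chain has an upper bound as well. *)
have [|A [[B0 BL B1] Amax]] :=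
    @Zorn_bigcup R (fun A => proper_ideal (fun x => A x \/ x \in I)).
  move=> F FP Ftot; split; first by right.
    move=> a x y [[A FA Ax]|Ix] [[B FB By]|Iy].
    - have [sub|sub] := Ftot A B FA FB.
        have [_ L _] := FP _ FB.
        by have [|h|h] := L a x y _ (or_introl By);
          [left; apply: sub|left; exists B|right].
      have [_ L _] := FP _ FA.
      by have [|h|h] := L a x y (or_introl Ax);
        [left; apply: sub|left; exists A|right].
    - have [_ L _] := FP _ FA.
      by have [h|h] := L a x y (or_introl Ax) (or_intror Iy);
        [left; exists A|right].
    - have [_ L _] := FP _ FB.
      by have [h|h] := L a x y (or_intror Ix) (or_introl By);
        [left; exists B|right].
    - by right; apply: IL.
  move=> [[A FA A1]|]; last exact/negP.
  by have [_ _ /(_ (or_introl A1))] := FP _ FA.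
pose m : {pred R^o} := [pred x : R^o | `[< A x \/ x \in I >]].
have mP x : x \in m <-> A x \/ x \in I by split=> /asboolP.
exists m; first split=> [|a x y /mP mx /mP my]; try exact/mP.
  by apply/mP; apply: BL.
split=> [x Ix||r rm]; first by apply/mP; right.
  by apply/negP => /mP.
apply: contrapT => h.
pose C : set R := fun x => exists a b, b \in m /\ x = a * r + b.
have mC x : x \in m -> C x by exists 0, x; rewrite mul0r add0r.
apply: (Amax C); first split.
- by move=> x Ax; apply: mC; apply/mP; left.
- move=> CA; move/negP: rm; apply; apply/mP; left; apply: CA.
  by exists 1, 0; rewrite mul1r addr0; split=> //; apply/mP.
have CE x : C x \/ x \in I <-> C x.
  by split=> [[//|Ix]|]; [apply: mC; apply/mP; right|left].
split; first by left; apply: mC; apply/mP.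
  move=> a x y /CE[c [d [dm ->]]] /CE[c' [d' [dm' ->]]]; left.
  exists (a * c + c'), (a * d + d'); split.
    by apply/mP; apply: BL; apply/mP.
  by rewrite mulrDr mulrDl mulrA addrACA.
move=> /CE[a [b [bm e]]]; apply: h; exists a.
by rewrite e addrC addKr.
Qed.

(** If [m] kills a nonzero [v], then [R v] is simple. *)
Lemma maximal_dense (M : lmodType R) (m : {pred R^o}) :
  ~ (exists S : {pred M}, simple_submod S) -> GRing.submod_closed m ->
  (forall r, r \notin m -> exists a : R, 1 - a * r \in m) ->
  dense M (fun r => r \in m).
Proof.
move=> nosimple mcl mmax v mv; apply: contrapT => v0; apply: nosimple.
pose S : {pred M} := [pred y | `[< exists a : R, y = a *: v >]].
exists S; split.
- split=> [|a x y]; first by apply/asboolP; exists 0; rewrite scale0r.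
  move=> /asboolP[b ->] /asboolP[c ->]; apply/asboolP; exists (a * b + c).
  by rewrite scalerDl scalerA.
- by exists v; [apply/asboolP; exists 1; rewrite scale1r|apply/eqP].
move=> T [T0 TL] TS.
have [[t tT t0]|h] := pselect (exists2 t, t \in T & t <> 0); last first.
  by left=> x xT; apply: contrapT => x0; apply: h; exists x.
right=> y /asboolP[b ->].
have /asboolP[r et] := TS t tT.
have [|a ar] := mmax r.
  by apply/negP => rm; apply: t0; rewrite et mv.
have -> : b *: v = (b * a) *: t + 0.
  rewrite addr0 et scalerA; apply/eqP; rewrite -subr_eq0 -scalerBl.
  by rewrite -mulrA -{1}[b]mulr1 -mulrBr -scalerA mv ?scaler0.
exact: TL.
Qed.
End MaximalIdeal.

(** * Tensoring with residue fields *)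

Lemma pureZr (R : comPzRingType) (M N : lmodType R) (x : M) (a : R) (y : N) :
  pure x (a *: y) = a *: pure x y.
Proof. by have := pure_linr x a y 0; rewrite pure0r !addr0. Qed.

Section TensorMap.
Variables (R : comPzRingType) (X Y Z : complex R).
Variable f : forall j, {linear Y j -> Z j}.

Definition tot_map_pure n (p : bideg n) (x : X (val p).1) (y : Y (val p).2) :
    tot X Z n :=
  @tot_in R X Z n _ _ (valP p) (pure x (f _ y)).
Fact tot_map_linl n (p : bideg n) y : linear ((@tot_map_pure n p)^~ y).
Proof. by move=> a x x'; rewrite /tot_map_pure pure_linl linearP. Qed.
Fact tot_map_linr n (p : bideg n) x : linear (@tot_map_pure n p x).
Proof. by move=> a y y'; rewrite /tot_map_pure linearP pure_linr linearP. Qed.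

Definition tot_map n : {linear tot X Y n -> tot X Z n} :=
  dsum_lift (fun p : bideg n =>
    tensor_lift (@tot_map_linl n p) (@tot_map_linr n p)
      : {linear @tot_summand R X Y n p -> tot X Z n}).

Lemma tot_map_in n i j (e : i + j == n) (x : X i) (y : Y j) :
  tot_map n (tot_in X Y e (pure x y)) = tot_in X Z e (pure x (f j y)).
Proof.
rewrite /tot_map /tot_in /= dsum_lift_in /= tensor_lift_pure /tot_map_pure.
exact: tot_in_irr.
Qed.

Lemma tot_map_d n (u : tot X Y n) :
  (forall j (y : Y j), f (j + 1) (cx_d Y j y) = cx_d Z j (f j y)) ->
  tot_map (n + 1) (tot_d X Y n u) = tot_d X Z n (tot_map n u).
Proof.
move=> fd; elim/tot_ind: u => [u v IHu IHv||i j e x y].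
- by rewrite !linearD IHu IHv.
- by rewrite !linear0.
rewrite tot_map_in !tot_d_in /tot_d_pure linearD linearZ.
by rewrite !tot_map_in fd.
Qed.
End TensorMap.

(** Modules are represented by complexes that are the same in every degree,
    which avoids a case distinction on the degree.  [R/m] is represented by
    [m * R] with differential [(j, r) |-> (0, j)], whose cohomology is [R/m] in
    each degree; no quotient module is formed. *)
Section ResidueComplex.
Variables (R : comPzRingType) (m : {pred R^o}).
Hypothesis mcl : GRing.submod_closed m.

Definition const_cx (N : lmodType R) : complex R :=
  @Complex R (fun=> N) (fun=> \0) (fun _ _ => erefl).

Let N : lmodType R := (submod mcl * R^o)%type.
Definition residue_d_fun (p : N) : N := (0, val p.1).
Fact residue_d_linear : linear residue_d_fun.
Proof.
by move=> a p q; congr (_, _); rewrite /= ?scaler0 ?addr0 // linearP.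
Qed.
HB.instance Definition _ :=
  GRing.isLinear.Build R N N *:%R residue_d_fun residue_d_linear.
Fact residue_dd (i : int) p : residue_d_fun (residue_d_fun p) = 0.
Proof. by []. Qed.
Definition residue_cx : complex R :=
  @Complex R (fun=> N) (fun=> residue_d_fun) residue_dd.

Lemma residue_torsion (M : lmodType R) :
  dense M (fun r => r \in m) -> homology_torsion M residue_cx.
Proof.
move=> dm i [j r] e.
have {e} j0 : j = 0 by apply: val_inj; exact: (congr1 snd e).
apply: denseS dm => a am.
have arm : (r : R) *: (a : R^o) \in m.
  by have [m0 mL] := mcl; have := mL r a 0 am m0; rewrite addr0.
exists (submod_in mcl arm, 0); rewrite j0; congr (_, _); rewrite /= ?scaler0 //.
exact: mulrC.
Qed.

Definition residue_in_fun (r : R^o) : N := (0, r).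
Fact residue_in_linear : linear residue_in_fun.
Proof. by move=> a p q; congr (_, _); rewrite /= scaler0 addr0. Qed.
HB.instance Definition _ :=
  GRing.isLinear.Build R R^o N *:%R residue_in_fun residue_in_linear.

Variable X : complex R.
Let iota := @tot_map R X (const_cx R^o) residue_cx (fun=> residue_in_fun).
Let pi := @tot_map R X residue_cx (const_cx R^o) (fun=> snd).

(** [pi] does not commute with the differentials, but it shows that the chain
    map [iota] is injective. *)
Lemma tensor_residue_inK n : cancel (iota n) (pi n).
Proof.
elim/tot_ind => [u v IHu IHv||i j e x y]; first by rewrite !linearD IHu IHv.
  by rewrite !linear0.
by rewrite /pi /iota !tot_map_in.
Qed.

Hypothesis flatR : absolutely_flat R.

(** A tensor involves finitely many elements of [m], and one [1 - a] kills
    all of them. *)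
Lemma tensor_residue_local n (u : tot X residue_cx n) :
  exists2 a : R, a \in m & exists u', (1 - a) *: u = iota n u'.
Proof.
have [m0 mL] := mcl.
have mM a b : b \in m -> a * b \in m.
  by move=> bm; rewrite -[a * b]addr0; apply: mL.
elim/tot_ind: u => [u v [a am [u' eu]] [b bm [v' ev]]||i j e x [[y ym] r]].
(* [1 - (a + b - a * b) = (1 - a) * (1 - b)] *)
- exists (a + b - a * b).
    have -> : a + b - a * b = (1 - b) * a + b.
      by rewrite mulrBl mul1r addrAC mulrC.
    exact: mL.
  exists ((1 - b) *: u' + (1 - a) *: v').
  have -> : iota n ((1 - b) *: u' + (1 - a) *: v') =
      (1 - b) *: iota n u' + (1 - a) *: iota n v' by rewrite linearD !linearZ.
  have -> : 1 - (a + b - a * b) = (1 - a) * (1 - b).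
    by rewrite mulrBr mulr1 mulrBl mul1r -[a + b - _]addrA opprD addrA.
  by rewrite -eu -ev !scalerA [(1 - b) * _]mulrC scalerDr.
- by exists 0 => //; exists 0; rewrite scaler0 linear0.
(* [z * y] is the idempotent generator of the ideal of [y]. *)
have [z ez] := flatR y.
exists (z * y); first exact: mM.
exists (tot_in X (const_cx R^o) e (pure x ((1 - z * y) *: r))).
rewrite /iota tot_map_in -linearZ -pureZr.
congr (tot_in X residue_cx e (pure x _)).
have zyy : (z * y) *: y = y.
  by rewrite [LHS](_ : _ = z * y * y) // -mulrA -expr2 mulrC -ez.
by congr (_, _); apply: val_inj; rewrite /= scalerBl scale1r zyy subrr.
Qed.

(** When [m] is maximal, [R/m] is the localisation of [R] at [m].  So if
    [X ⊗ R/m] is acyclic, every cycle of [X ⊗ R] becomes a boundary after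
    multiplication by a scalar outside [m], which can be taken in [1 + m]. *)
Lemma residue_acyclic_local : acyclic (tensor_cx X residue_cx) ->
  forall n (z : tensor_cx X (const_cx R^o) (n + 1)), is_cycle z ->
    exists2 a : R, a \in m &
      @is_boundary R (tensor_cx X (const_cx R^o)) n ((1 - a) *: z).
Proof.
move=> acy n z cz.
have iotad k (u : tot X (const_cx R^o) k) :
    iota (k + 1) (tot_d X _ k u) = tot_d X residue_cx k (iota k u).
  by apply: tot_map_d => j y; congr (_, _).
have [|w ew] := acy n (iota _ z).
  by rewrite /is_cycle /= -iotad cz linear0.
have [a am [w' ew']] := tensor_residue_local w.
exists a => //; exists w'.
apply: (can_inj (@tensor_residue_inK _)); rewrite iotad -ew' linearZ /=.
by rewrite linearZ; congr (_ *: _).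
Qed.
End ResidueComplex.

Theorem corollary4p9 (R : comPzRingType) :
  ~ noetherian R -> absolutely_flat R -> ~ semi_artinian R ->
  exists L : complex R -> Prop, localising L /\ ~ bousfield_class L.
Proof.
move=> _ flatR nsa; apply: contrapT => noL; apply: nsa => M f _ [v v0].
apply: contrapT => nosimple; apply: noL.
exists (homology_torsion M); split; first exact: homology_torsion_localising.
move=> [X LX].
have ntR : ~ homology_torsion M (const_cx R^o).
  move=> /(_ 0 1 erefl) d1; move/eqP: v0; apply; apply: d1 => a [_ /= e].
  have a0 : a = 0 by rewrite -[a]mulr1.
  by rewrite a0 scale0r.
apply/ntR/LX/iso0_acyclic => n z cz.
pose I : {pred R^o} := [pred r : R^o | `[< is_boundary ((r : R) *: z) >]].
have Icl : GRing.submod_closed I.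
  split=> [|a x y /asboolP bx /asboolP by_]; apply/asboolP.
    by rewrite scale0r; apply: is_boundary0.
  rewrite scalerDl -scalerA; apply: is_boundaryD => //; exact: is_boundaryZ.
have [/asboolP|I1] := boolP (1 \in I); first by rewrite scale1r.
have [m mcl [Im m1 mmax]] := maximal_ideal Icl I1.
have /LX/acyclic_iso0 acy : homology_torsion M (residue_cx mcl).
  exact/residue_torsion/maximal_dense.
have [a am b] := residue_acyclic_local flatR acy cz.
have m1a : 1 - a \in m by apply: Im; apply/asboolP.
move/negP: m1; case; have [_ mL] := mcl.
by have := mL 1 _ _ m1a am; rewrite scale1r subrK.
Qed.
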